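(* Let $I=[x_1,x_N]$ with partition $x_1<\dots<x_N$ and affine maps $u_i(x)=a_ix+b_i$ with $u_i(x_1)=x_i$, $u_i(x_N)=x_{i+1}$ ($i\in\mathbb{N}_{N-1}$). Let $f\in C(I)$ with $f\ge0$ on $I$, and let $\{q_n\}_{n\ge1}$ be a sequence in $(0,1]$ with $\lim q_n=1$. For $n\in\mathbb{N}$, $i\in\mathbb{N}_{N-1}$ set $\phi(f,i)=\min_{x\in I}f(u_i(x))$, $\Phi(f,i)=\max_{x\in I}f(u_i(x))$, $\phi_n=\min_{x\in I}M_{n,q_n}f(x)$, $\Phi_n=\max_{x\in I}M_{n,q_n}f(x)$, and let $C_n$ be a positive real number strictly larger than $\max\{\phi_n,\|f\|_\infty\}$. Suppose the continuous scaling functions $\alpha_i$ satisfy (1) $\|\alpha\|_\infty<1$ and (2) for all $n\in\mathbb{N}$, $i\in\mathbb{N}_{N-1}$, $x\in I$: \[ \max\left\{\frac{-\phi(f,i)}{C_n-\phi_n},\,-\frac{C_n-\Phi(f,i)}{\Phi_n}\right\}\le\alpha_i(x)\le\min\left\{\frac{\phi(f,i)}{\Phi_n},\,\frac{C_n-\Phi(f,i)}{C_n-\phi_n}\right\}. \] Then the quantum MKZ-fractal functions $f^{(q_n,\alpha)}_n$, $n\in\mathbb{N}$, are non-negative on $I$ and converge uniformly to $f$.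
   Context: For $q\in(0,1]$: $[k]_q=\frac{1-q^k}{1-q}$ ($q\ne1$), $[k]_1=k$, $q$-factorials and $\binom{n}{k}_q=\frac{[n]_q!}{[k]_q![n-k]_q!}$. Quantum MKZ operator: $M_{n,q}f(x)=P_{n,q}(x)\sum_{k\ge0}\binom{n+k}{k}_q\left(\frac{x-x_1}{x_N-x_1}\right)^k f\!\left(x_1+(x_N-x_1)\frac{[k]_q}{[k+n]_q}\right)$ for $x_1\le x<x_N$, $M_{n,q}f(x_N)=f(x_N)$, $P_{n,q}(x)=\prod_{j=0}^n(x_N-x_1-q^j(x-x_1))/(x_N-x_1)^{n+1}$. Scaling functions $\alpha_i\in C(I)$, $\|\alpha\|_\infty=\max_i\|\alpha_i\|_\infty$. The quantum MKZ-fractal function $f^{(q,\alpha)}_n$ is the unique $g\in C(I)$ with $g(u_i(x))=f(u_i(x))+\alpha_i(x)(g(x)-M_{n,q}f(x))$ for all $x\in I$, $i\in\mathbb{N}_{N-1}$. *)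

(* Defs.v *)
From HB Require Import structures.
From mathcomp Require Import all_boot all_order all_algebra.
From mathcomp Require Import all_classical all_reals all_analysis.
Set Implicit Arguments. Unset Strict Implicit. Unset Printing Implicit Defensive.
Import Order.TTheory GRing.Theory Num.Theory numFieldNormedType.Exports.
Local Open Scope classical_set_scope.
Local Open Scope ring_scope.

Section QMKZ.
Variable R : realType.

Definition qint (q : R) (k : nat) : R :=
  if q == 1 then k%:R else (1 - q ^+ k) / (1 - q).

Definition qfact (q : R) (k : nat) : R := \prod_(1 <= j < k.+1) qint q j.

Definition qbinom (q : R) (n k : nat) : R :=
  qfact q n / (qfact q k * qfact q (n - k)).

Definition Pnq (a b : R) (n : nat) (q : R) (x : R) : R :=
  (\prod_(0 <= j < n.+1) (b - a - q ^+ j * (x - a))) / (b - a) ^+ n.+1.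

Definition MKZ (a b : R) (n : nat) (q : R) (f : R -> R) (x : R) : R :=
  if x == b then f b
  else Pnq a b n q x *
       limn (series (fun k : nat => qbinom q (n + k) k * ((x - a) / (b - a)) ^+ k *
                     f (a + (b - a) * (qint q k / qint q (k + n))))).

(* min / max / sup-norm over I, for continuous functions (attained) *)
Definition minI (a b : R) (g : R -> R) : R := inf (g @` `[a, b]).
Definition maxI (a b : R) (g : R -> R) : R := sup (g @` `[a, b]).
Definition supnormI (a b : R) (g : R -> R) : R := sup ((fun x => `|g x|) @` `[a, b]).

Definition is_qMKZ_fractal (x : nat -> R) (N : nat) (u : nat -> R -> R)
  (alpha : nat -> R -> R) (n : nat) (q : R) (f g : R -> R) : Prop :=
  {within `[x 1%N, x N], continuous g} /\
  forall i, (1 <= i < N)%N -> forall t, t \in `[x 1%N, x N] ->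
    g (u i t) = f (u i t) + alpha i t * (g t - MKZ (x 1%N) (x N) n q f t).

(* f^{(q,alpha)}_n : the (unique on I) function with the above property *)
Definition qMKZ_fractal (x : nat -> R) (N : nat) (u : nat -> R -> R)
  (alpha : nat -> R -> R) (n : nat) (q : R) (f : R -> R) : R -> R :=
  xget (fun _ => 0) [set g | is_qMKZ_fractal x N u alpha n q f g].

End QMKZ.

(* Main.v *)
Require Import Defs.
From HB Require Import structures.
From mathcomp Require Import all_boot all_order all_algebra.
From mathcomp Require Import all_classical all_reals all_analysis.
From mathcomp Require Import ring lra.
Import Order.TTheory GRing.Theory Num.Theory numFieldNormedType.Exports.
Local Open Scope classical_set_scope.
Local Open Scope ring_scope.

(* With y = (t - x_1) / (x_N - x_1), the numbers
   w_k = prod_{j <= n} (1 - q^j y) * binom(n + k, k)_q * y^k are nonnegative weights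
   of total mass 1 (q-binomial series), and the nodes s_k = [k] / [n + k] satisfy
   sum w_k s_k = y and sum w_k s_k^2 <= y^2 + y / [n].  Chebyshev's argument then
   bounds |M_n f - f| by e + K / [n]_{q_n}, and [n]_{q_n} tends to infinity.

   The fractal function is f + h, where h is the sum of the iterates of the
   s-contraction w |-> (alpha_i w) o u_i^-1 applied to f - M_n f; this is legitimate
   because f - M_n f vanishes at both endpoints.  The self-referential equation
   turns |g - f| <= m into |g - f| <= s (m + |f - M_n f|), which gives the uniform
   convergence, and turns -m <= g <= C_n + m into -s m <= g <= C_n + s m, which
   gives 0 <= g. *)

(** * q-integers and the q-binomial series *)

Section QBinomialSeries.
Variables (R : realType) (q : R).
Hypothesis q01 : 0 < q <= 1.

Let q_gt0 : 0 < q. Proof. by case/andP: q01. Qed.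
Let q_le1 : q <= 1. Proof. by case/andP: q01. Qed.

Lemma qintE k : qint q k = \sum_(0 <= j < k) q ^+ j.
Proof.
rewrite /qint; case: eqP => [->|/eqP q1].
  under eq_bigr do rewrite expr1n.
  by rewrite sumr_const_nat subn0.
have q1' : 1 - q != 0 by rewrite subr_eq0 eq_sym.
apply: (mulIf q1'); rewrite divfK// big_mkord.
by rewrite -opprB subrX1 -mulNr opprB mulrC.
Qed.

Lemma qint0 : qint q 0 = 0.
Proof. by rewrite qintE big_geq. Qed.

Lemma qintSr k : qint q k.+1 = qint q k + q ^+ k.
Proof. by rewrite !qintE big_nat_recr. Qed.

Lemma qintS k : qint q k.+1 = 1 + q * qint q k.
Proof.
elim: k => [|k IH]; first by rewrite qintSr qint0 expr0 mulr0 addrC.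
by rewrite [LHS]qintSr {1}IH qintSr exprS; ring.
Qed.

Lemma qintD k m : qint q (k + m) = qint q m + q ^+ m * qint q k.
Proof.
elim: k => [|k IH]; first by rewrite add0n qint0 mulr0 addr0.
by rewrite addSn !qintSr IH exprD; ring.
Qed.

Lemma qint_ge0 k : 0 <= qint q k.
Proof. by rewrite qintE; apply: sumr_ge0 => j _; rewrite exprn_ge0// ltW. Qed.

Lemma qint_gt0 k : 0 < qint q k.+1.
Proof. by rewrite qintSr ltr_wpDl ?qint_ge0 ?exprn_gt0. Qed.

Lemma le_qint k m : (k <= m)%N -> qint q k <= qint q m.
Proof.
move=> /subnK <-; rewrite qintD lerDl.
by rewrite mulr_ge0 ?qint_ge0// exprn_ge0// ltW.
Qed.

Lemma qfactS k : qfact q k.+1 = qfact q k * qint q k.+1.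
Proof. by rewrite /qfact big_nat_recr. Qed.

Lemma qfact_gt0 k : 0 < qfact q k.
Proof.
elim: k => [|k IH]; first by rewrite /qfact big_geq.
by rewrite qfactS mulr_gt0 ?qint_gt0.
Qed.

Local Notation c n k := (qbinom q (n + k) k).

Lemma qbinomDE n k : c n k = qfact q (n + k) / (qfact q k * qfact q n).
Proof. by rewrite /qbinom addnK. Qed.

Lemma qbinom_gt0 n k : 0 < c n k.
Proof. by rewrite qbinomDE divr_gt0 ?mulr_gt0 ?qfact_gt0. Qed.

Lemma qbinom_n0 n : c n 0 = 1.
Proof.
rewrite qbinomDE addn0 /qfact [X in _ / (X * _)]big_geq// mul1r divff//.
by rewrite gt_eqF// qfact_gt0.
Qed.

Lemma qbinom_0n k : c 0 k = 1.
Proof.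
rewrite qbinomDE add0n /qfact [X in _ / (_ * X)]big_geq// mulr1 divff//.
by rewrite gt_eqF// qfact_gt0.
Qed.

(** Dividing out the common q-factorials leaves [[n+k+2] = [n+1] + q^(n+1) [k+1]], an instance of
    [qintD]. *)
Lemma qbinom_pascal n k : c n.+1 k.+1 = c n k.+1 + q ^+ n.+1 * c n.+1 k.
Proof.
rewrite !qbinomDE addnS (addSnnS n k) !addnS !qfactS.
have -> : qint q (n + k).+2 = qint q n.+1 + q ^+ n.+1 * qint q k.+1.
  by rewrite -qintD addSn addnS addnC.
have h1 := lt0r_neq0 (qfact_gt0 k); have h2 := lt0r_neq0 (qfact_gt0 n).
have h3 := lt0r_neq0 (qint_gt0 k); have h4 := lt0r_neq0 (qint_gt0 n).
by field; rewrite h1 h2 h3 h4.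
Qed.

(** Source of the index shift in the moments: the node is exactly the ratio of consecutive
    coefficients. *)
Lemma qbinom_ratio n k :
  c n.+1 k.+1 * (qint q k.+1 / qint q (k.+1 + n.+1)) = c n.+1 k.
Proof.
rewrite !qbinomDE addnS !qfactS.
have -> : (k.+1 + n.+1 = (n.+1 + k).+1)%N by rewrite addSn addnC.
have h1 := lt0r_neq0 (qfact_gt0 k); have h2 := lt0r_neq0 (qfact_gt0 n).
have h3 := lt0r_neq0 (qint_gt0 k); have h4 := lt0r_neq0 (qint_gt0 n).
have h5 := lt0r_neq0 (qint_gt0 (n.+1 + k)).
by field; rewrite h1 h2 h3 h4 h5.
Qed.

(** Induction on [n] from the geometric series: Pascal's rule turns the partial sums into the
    recursion [s (m+1) = t (m+1) + r * s m] with [r = q^(n+1) y < 1], so the limit solves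
    [S = T + r S]. *)
Lemma q_binomial_series n (y : R) : 0 <= y < 1 ->
  series (fun k => c n k * y ^+ k) m @[m --> \oo] -->
  (\prod_(0 <= j < n.+1) (1 - q ^+ j * y))^-1.
Proof.
move=> /andP[y0 y1]; elim: n => [|n IH].
  rewrite big_nat1 expr0 mul1r -[X in _ --> X]mul1r.
  rewrite (_ : (fun k => c 0 k * y ^+ k) = geometric 1 y); last first.
    by apply/funext => k /=; rewrite qbinom_0n.
  by apply: cvg_geometric_series; rewrite ger0_norm.
rewrite big_nat_recr//= invfM.
set T := _^-1 in IH *; set r := q ^+ n.+1 * y.
have r0 : 0 <= r by rewrite mulr_ge0 ?exprn_ge0// ltW.
have r1 : r < 1.
  by rewrite (le_lt_trans _ y1)// ler_piMl// exprn_ile1// ltW.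
set t := series _ in IH; set s := series _.
have c_ge0 m k : 0 <= c m k * y ^+ k.
  by rewrite mulr_ge0 ?exprn_ge0// ltW// qbinom_gt0.
have recs m : s m.+1 = t m.+1 + r * s m.
  rewrite /s /t !seriesEnat /= [LHS]big_nat_recl// [in RHS]big_nat_recl//.
  rewrite !expr0 !qbinom_n0 -addrA; congr (_ + _).
  rewrite mulr_sumr -big_split/=; apply: eq_bigr => k _.
  rewrite qbinom_pascal /r (exprS y k); set u := q ^+ _; ring.
have tT m : t m <= T.
  have <- : limn t = T by apply: cvg_lim.
  apply: nondecreasing_cvgn_le; last by apply/cvg_ex; exists T.
  exact: nondecreasing_series.
(* [T / (1 - r)] is the fixed point of [z |-> T + r z], so the recursion preserves it as an upper
   bound; monotone convergence then applies. *)
have sle m : s m <= T / (1 - r).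
  have T0 : 0 <= T by rewrite (le_trans _ (tT 0%N))// /t seriesEnat/= big_geq.
  elim: m => [|m IHm].
    by rewrite /s seriesEnat/= big_geq// divr_ge0// subr_ge0 ltW.
  rewrite recs (le_trans (lerD (tT _) (ler_wpM2l r0 IHm)))//.
  by rewrite le_eqVlt; apply/orP; left; apply/eqP; field; rewrite subr_eq0 gt_eqF.
have cvs : cvgn s.
  apply: nondecreasing_is_cvgn; first exact: nondecreasing_series.
  by exists (T / (1 - r)) => _ [m _ <-].
suff <- : limn s = T / (1 - r) by [].
have : s m.+1 @[m --> \oo] --> T + r * limn s.
  under eq_fun do rewrite recs.
  apply: cvgD; first by rewrite cvg_shiftS.
  by apply: cvgMl_tmp.
rewrite cvg_shiftS => /(cvg_lim (@norm_hausdorff _ _)) e.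
have r1' : 1 - r != 0 by rewrite subr_eq0 gt_eqF.
by apply: (mulIf r1'); rewrite divfK// mulrBr mulr1 {1}e; ring.
Qed.

End QBinomialSeries.

(** * Moments of the Meyer-Koenig-Zeller weights *)

Section WeightedSeries.
Variables (R : realType) (w z : nat -> R) (Z : R).
Hypothesis w_ge0 : forall k, 0 <= w k.
Hypothesis z_le : forall k, `|z k| <= Z.

Lemma is_cvg_weighted_series : cvgn (series w) ->
  cvgn (series (fun k => w k * z k)).
Proof.
move=> cw; apply: normed_cvg.
have Z0 : 0 <= Z by rewrite (le_trans _ (z_le 0%N)).
apply: (@series_le_cvg _ _ (fun k => Z * w k)) => [k|k|k|].
- exact: normr_ge0.
- by rewrite mulr_ge0.
- by rewrite /= normrM (ger0_norm (w_ge0 k)) mulrC ler_wpM2r.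
- have -> : series (fun k => Z * w k) = (fun m => Z * series w m).
    by apply/funext => m; rewrite !seriesEnat/= mulr_sumr.
  exact: is_cvgMl_tmp.
Qed.

(** Mass 1 lets [v] be written as the sum of [w k * v], so the difference is dominated termwise by
    [w k * B k]. [T] only bounds the partial sums, which leaves room for an inequality on the second
    moment. *)
Lemma weighted_series_dist (B T : nat -> R) (v L : R) :
  series w m @[m --> \oo] --> (1 : R) ->
  (forall k, `|z k - v| <= B k) ->
  (forall m, series (fun k => w k * B k) m <= T m) ->
  T m @[m --> \oo] --> L ->
  `|limn (series (fun k => w k * z k)) - v| <= L.
Proof.
move=> w1 zB BT TL.
have cwz := is_cvg_weighted_series (cvgP _ w1).
have lim_wz : `|series (fun k => w k * z k) m - v * series w m| @[m --> \oo] -->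
    `|limn (series (fun k => w k * z k)) - v|.
  rewrite -[X in _ - X]mulr1; apply: cvg_norm; apply: cvgB => //.
  exact: cvgMl_tmp.
apply: (ler_cvg_to lim_wz TL); near=> m.
apply: le_trans (BT m).
rewrite !seriesEnat/= mulr_sumr -sumrB (le_trans (ler_norm_sum _ _ _))//.
apply: ler_sum => k _.
by rewrite mulrC -mulrBl normrM (ger0_norm (w_ge0 k)) mulrC ler_wpM2l.
Unshelve. all: by end_near. Qed.

End WeightedSeries.

Section MKZWeights.
Variables (R : realType) (q : R) (n : nat) (y : R).
Hypothesis q01 : 0 < q <= 1.
Hypothesis y01 : 0 <= y < 1.

(** The normalizing product sits inside the weight so that the total mass is 1. *)
Definition mkz_weight k : R :=
  (\prod_(0 <= j < n.+1) (1 - q ^+ j * y)) * (qbinom q (n + k) k * y ^+ k).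

Definition mkz_node (k : nat) : R := qint q k / qint q (k + n).

Local Notation w := mkz_weight.
Local Notation s := mkz_node.

Lemma mkz_prod_gt0 : 0 < \prod_(0 <= j < n.+1) (1 - q ^+ j * y).
Proof.
have /andP[q0 q1] := q01; have /andP[y0 y1] := y01.
apply: prodr_gt0 => j _; rewrite subr_gt0 (le_lt_trans _ y1)//.
by rewrite ler_piMl// exprn_ile1// ltW.
Qed.

Lemma mkz_weight_ge0 k : 0 <= w k.
Proof.
have /andP[y0 _] := y01.
rewrite mulr_ge0 ?(ltW mkz_prod_gt0)//.
by rewrite mulr_ge0 ?exprn_ge0// ltW// qbinom_gt0.
Qed.

Lemma mkz_node_ge0 k : 0 <= s k.
Proof. by rewrite divr_ge0 ?qint_ge0. Qed.

Lemma mkz_node_le1 k : s k <= 1.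
Proof.
(* For [k + n = 0] the denominator is 0 and the quotient takes the default value 0. *)
rewrite /mkz_node; case: (posnP (k + n)) => [->|kn].
  by rewrite qint0 invr0 mulr0.
have kn0 : 0 < qint q (k + n) by rewrite -(prednK kn) qint_gt0.
by rewrite ler_pdivrMr// mul1r le_qint// leq_addr.
Qed.

Lemma mkz_weight_sum : series w m @[m --> \oo] --> (1 : R).
Proof.
have -> : series w = (fun m => (\prod_(0 <= j < n.+1) (1 - q ^+ j * y)) *
    series (fun k => qbinom q (n + k) k * y ^+ k) m).
  by apply/funext => m; rewrite !seriesEnat/= mulr_sumr.
rewrite -[X in _ --> X](divff (lt0r_neq0 mkz_prod_gt0)).
apply: cvgMl_tmp; exact: q_binomial_series.
Qed.

Hypothesis n_gt0 : (0 < n)%N.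

(** [qbinom_ratio], taken at [n.-1], absorbs the node and one factor [y] comes out; each moment thus
    reduces to one of lower order. *)
Lemma mkz_weight_nodeS k : w k.+1 * s k.+1 = y * w k.
Proof.
rewrite /mkz_weight /mkz_node -(prednK n_gt0).
rewrite -(qbinom_ratio _ _ q01 n.-1 k) (exprS y k); ring.
Qed.

Lemma mkz_node0 : s 0 = 0.
Proof. by rewrite /mkz_node qint0 mul0r. Qed.

Lemma mkz_sum_node m :
  series (fun k => w k * s k) m.+1 = y * series w m.
Proof.
rewrite !seriesEnat/= big_nat_recl// mkz_node0 mulr0 add0r mulr_sumr.
by apply: eq_bigr => k _; rewrite mkz_weight_nodeS.
Qed.

Lemma mkz_mean : series (fun k => w k * s k) m @[m --> \oo] --> y.
Proof.
rewrite -[X in _ --> X]mulr1 -cvg_shiftS; under eq_fun do rewrite mkz_sum_node.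
by apply: cvgMl_tmp; exact: mkz_weight_sum.
Qed.

(* [k+1] = 1 + q [k] splits the node s_{k+1} into 1/[n+k+1] and a part below s_k *)
Lemma mkz_nodeS_le k : s k.+1 <= (qint q n)^-1 + s k.
Proof.
have /andP[q0 q1] := q01.
have kn0 j : 0 < qint q (j + n).
  by rewrite -(prednK n_gt0) addnS qint_gt0.
rewrite /mkz_node qintS mulrDl mul1r; apply: lerD.
  by rewrite lef_pV2 ?posrE ?kn0//; [exact: le_qint (leq_addl _ _)|exact: (kn0 0%N)].
have q0' := ltW q0.
rewrite addSn; apply: ler_pM; rewrite ?invr_ge0 ?mulr_ge0 ?qint_ge0//.
  by rewrite ler_piMl ?qint_ge0.
by rewrite lef_pV2 ?posrE ?kn0//; [exact: le_qint|exact: (kn0 k.+1)].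
Qed.

(** One factor of the square is removed by the index shift, the other is estimated by
    [mkz_nodeS_le]. *)
Lemma mkz_sum_node_sqr m :
  series (fun k => w k * s k ^+ 2) m <=
  y * ((qint q n)^-1 * series w m + series (fun k => w k * s k) m).
Proof.
have /andP[y0 _] := y01.
have iq0 : 0 <= (qint q n)^-1 by rewrite invr_ge0 qint_ge0.
case: m => [|m]; first by rewrite !seriesEnat/= !big_geq// !mulr0 addr0 mulr0.
rewrite (seriesEnat (fun k => w k * s k ^+ 2))/= big_nat_recl// mkz_node0 expr0n mulr0 add0r.
apply: (@le_trans _ _ (y * ((qint q n)^-1 * series w m +
    series (fun k => w k * s k) m))).
  rewrite !seriesEnat/= !mulr_sumr -big_split/= mulr_sumr; apply: ler_sum => k _.
  rewrite expr2 mulrA mkz_weight_nodeS -mulrA ler_wpM2l//.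
  by rewrite (mulrC _ (w k)) -mulrDr ler_wpM2l ?mkz_weight_ge0// mkz_nodeS_le.
(* The shift has cost one index: the nonnegative terms of index [m] are added back. *)
rewrite ler_wpM2l// lerD ?ler_wpM2l// !seriesEnat/= big_nat_recr//= lerDl.
  exact: mkz_weight_ge0.
by rewrite mulr_ge0 ?mkz_node_ge0 ?mkz_weight_ge0.
Qed.

Variables (z : nat -> R) (Z v e K : R).
Hypothesis z_le : forall k, `|z k| <= Z.
Hypothesis K_ge0 : 0 <= K.

(** Expand [(s k - y)^2] and use mass 1, mean [y] and the second-moment bound; in the limit [y
    (1/[n] + y) - 2 y^2 + y^2 = y / [n]]. *)
Lemma mkz_dist :
  (forall k, `|z k - v| <= e + K * (s k - y) ^+ 2) ->
  `|limn (series (fun k => w k * z k)) - v| <= e + K * (y / qint q n).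
Proof.
move=> zv; have /andP[y0 y1] := y01.
have iq0 : 0 <= (qint q n)^-1 by rewrite invr_ge0 qint_ge0.
pose E m := series (fun k => w k * s k) m; pose W m := series w m.
apply: (@le_trans _ _ (e * 1 + K * (y * ((qint q n)^-1 * 1 + y) -
    2 * y * y + y ^+ 2 * 1))); last first.
  by rewrite le_eqVlt; apply/orP; left; apply/eqP; ring.
apply: (@weighted_series_dist _ _ _ _ mkz_weight_ge0 z_le _
  (fun m => e * W m + K * (y * ((qint q n)^-1 * W m + E m) -
      2 * y * E m + y ^+ 2 * W m)) _ _ mkz_weight_sum zv) => [m|].
  rewrite (_ : series _ m = e * W m + K * (series (fun k => w k * s k ^+ 2) m -
      2 * y * E m + y ^+ 2 * W m)).
    by rewrite lerD2l ler_wpM2l// !lerD2r mkz_sum_node_sqr.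
  rewrite /E /W !seriesEnat/= !mulr_sumr -sumrN -!big_split/= mulr_sumr.
  by rewrite -big_split/=; apply: eq_bigr => k _; ring.
have W1 : W m @[m --> \oo] --> (1 : R) := mkz_weight_sum.
have Ey : E m @[m --> \oo] --> y := mkz_mean.
apply: cvgD; first exact: cvgMl_tmp.
apply: cvgMl_tmp; apply: cvgD; last exact: cvgMl_tmp.
apply: cvgB; last exact: cvgMl_tmp.
by apply: cvgMl_tmp; apply: cvgD => //; exact: cvgMl_tmp.
Qed.

(** The error is now linear in the node, so mass and mean suffice. It serves the continuity of the
    operator at the right endpoint. *)
Lemma mkz_dist_endpoint :
  (forall k, `|z k - v| <= e + K * (1 - s k)) ->
  `|limn (series (fun k => w k * z k)) - v| <= e + K * (1 - y).
Proof.
move=> zv.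
pose E m := series (fun k => w k * s k) m; pose W m := series w m.
rewrite -(mulr1 e).
apply: (@weighted_series_dist _ _ _ _ mkz_weight_ge0 z_le _
  (fun m => e * W m + K * (W m - E m)) _ _ mkz_weight_sum zv) => [m|].
  rewrite le_eqVlt; apply/orP; left; apply/eqP.
  rewrite /E /W !seriesEnat/= -sumrB !mulr_sumr -big_split/=.
  by apply: eq_bigr => k _; ring.
have W1 : W m @[m --> \oo] --> (1 : R) := mkz_weight_sum.
have Ey : E m @[m --> \oo] --> y := mkz_mean.
by apply: cvgD; [|apply: cvgMl_tmp; apply: cvgB]; rewrite //; exact: cvgMl_tmp.
Qed.

End MKZWeights.

(** * Dominated series and continuous functions on a segment *)

Section MTest.
Variables (R : realType) (M : nat -> R).
Hypothesis cM : cvgn (series M).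

Lemma dominated_is_cvg_series (u : nat -> R) :
  (forall k, `|u k| <= M k) -> cvgn (series u).
Proof.
move=> uM; apply: normed_cvg; apply: (@series_le_cvg _ _ M) => // k.
  exact: normr_ge0.
by rewrite (le_trans _ (uM k)).
Qed.

Lemma dominated_series_tail (u : nat -> R) m :
  (forall k, `|u k| <= M k) ->
  `|limn (series u) - series u m| <= limn (series M) - series M m.
Proof.
move=> uM; have cu := dominated_is_cvg_series _ uM.
have hu : `|series u p - series u m| @[p --> \oo] -->
    `|limn (series u) - series u m|.
  by apply: cvg_norm; apply: cvgB => //; exact: cvg_cst.
have hM : series M p - series M m @[p --> \oo] -->
    limn (series M) - series M m.
  by apply: cvgB => //; exact: cvg_cst.
apply: (ler_cvg_to hu hM); near=> p.
have mp : (m <= p)%N by near: p; exact: nbhs_infty_ge.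
rewrite !sub_series mp (le_trans (ler_norm_sum _ _ _))//.
by apply: ler_sum => k _.
Unshelve. all: by end_near. Qed.

(** Weierstrass test with three thirds of [e]; domination is required only near [x], which suits
    power series inside their disc of convergence. *)
Lemma continuous_series (w : nat -> R -> R) (x : R) :
  (forall k, {for x, continuous (w k)}) ->
  (\forall t \near x, forall k, `|w k t| <= M k) ->
  {for x, continuous (fun t => limn (series (w^~ t)))}.
Proof.
move=> cw wM; apply/cvgrPdist_lt => e e0.
have e3 : 0 < e / 3 by rewrite divr_gt0.
have [m Mm] : exists m, limn (series M) - series M m < e / 3.
  have /cvgrPdist_lt/(_ _ e3)[m _ /(_ m (leqnn m))] := cM.
  by exists m; rewrite (le_lt_trans (ler_norm _)).
have cS : {for x, continuous (fun t => series (w^~ t) m)}.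
  rewrite /series/=; by apply: cvg_big => [|k _]; [exact: add_continuous|exact: cw].
have := cS => /cvgrPdist_lt/(_ _ e3) cSe.
have wMx : forall k, `|w k x| <= M k by exact: nbhs_singleton wM.
near=> t.
have wMt : forall k, `|w k t| <= M k by near: t.
have h1 := le_lt_trans (dominated_series_tail _ m wMx) Mm.
have h2 := le_lt_trans (dominated_series_tail _ m wMt) Mm.
have h3 : `|series (w^~ x) m - series (w^~ t) m| < e / 3 by near: t.
move: h1 h2 h3; rewrite !ltr_norml => /andP[? ?] /andP[? ?] /andP[? ?].
by apply/andP; split; lra.
Unshelve. all: by end_near. Qed.

End MTest.

Section Clamp.
Variables (R : realType) (a b : R).
Hypothesis ab : a <= b.

(** Composition with this retraction replaces continuity within the segment by continuity on the
    whole line. *)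
Definition clamp (t : R) : R := Num.max a (Num.min b t).

Lemma clamp_itv t : clamp t \in `[a, b].
Proof. by rewrite in_itv/= /clamp le_max lexx/= ge_max ab/= ge_min lexx. Qed.

Lemma clamp_id t : t \in `[a, b] -> clamp t = t.
Proof. by rewrite in_itv/= /clamp => /andP[ta tb]; rewrite min_r// max_r. Qed.

Lemma clamp_le t : t <= a -> clamp t = a.
Proof. by move=> ta; rewrite /clamp max_l// ge_min ta orbT. Qed.

Lemma clamp_ge t : b <= t -> clamp t = b.
Proof. by move=> bt; rewrite /clamp min_l// max_r. Qed.

Lemma continuous_clamp : continuous clamp.
Proof.
move=> t; apply: (@continuous_max R R (cst a)); first exact: cvg_cst.
by apply: (@continuous_min R R (cst b) id); [exact: cvg_cst|exact: cvg_id].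
Qed.

Variable f : R -> R.
Hypothesis cf : {within `[a, b], continuous f}.

Lemma continuous_comp_clamp : continuous (fun t => f (clamp t)).
Proof.
move=> t; have ct : `[a, b]%classic (clamp t) := clamp_itv t.
have /subspace_continuousP/(_ _ ct) := cf.
move=> /cvgrPdist_lt fc; apply/cvgrPdist_lt => e /fc.
rewrite near_withinE => /continuous_clamp h.
have h' : \forall s \near t, `[a, b]%classic (clamp s) -> `|f (clamp t) - f (clamp s)| < e.
  exact: h.
by apply: filterS h' => s; apply; exact: clamp_itv.
Qed.

Lemma continuous_itv_bounded : exists2 Z, 0 <= Z &
  forall t, t \in `[a, b] -> `|f t| <= Z.
Proof.
have [M _ fM] := EVT_max ab cf; have [m _ fm] := EVT_min ab cf.
exists (`|f M| + `|f m|) => [|t tab]; first by rewrite addr_ge0.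
rewrite ler_norml; apply/andP; split.
  rewrite (le_trans _ (fm t tab))// lerNl.
  by rewrite (le_trans (ler_norm _))// normrN lerDr.
by rewrite (le_trans (fM t tab))// (le_trans (ler_norm _))// lerDl.
Qed.

(** Heine-Cantor, from compactness in its near-covering form applied to the clamped function. *)
Lemma continuous_itv_uniform e : 0 < e -> exists2 d, 0 < d &
  forall s t, s \in `[a, b] -> t \in `[a, b] -> `|s - t| < d ->
    `|f s - f t| < e.
Proof.
move=> e0; pose F t := f (clamp t).
pose P (d t : R) := forall s, `|s - t| < d -> `|F s - F t| < e.
have /compact_near_coveringP cov := @segment_compact R a b.
have [d d0 dP] : exists2 d, 0 < d & `[a, b] `<=` P d.
  suff : \forall d \near 0^'+, `[a, b] `<=` P d.
    move=> H; have [d [d0 Pd]] : exists d, 0 < d /\ `[a, b] `<=` P d.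
      apply: (@filter_ex _ (0^'+ : set_system R)).
      by apply: filterI => //; exact: nbhs_right_gt.
    by exists d.
  apply: cov => x _.
  have e2 : 0 < e / 2 by rewrite divr_gt0.
  have /cvgrPdist_lt/(_ _ e2)[r /= r0 rF] := @continuous_comp_clamp x.
  (* Halving [r] for both [t] and [d] keeps [s] and [t] within [r] of [x]. *)
  exists (ball x (r / 2), [set d | d < r / 2]) => /=.
    by split; [apply: nbhsx_ballx|apply: nbhs_right_lt]; rewrite divr_gt0.
  move=> [t d] /= [xt dr] s st.
  have xs : `|x - s| < r.
    rewrite (splitr r) -(subrK t x) -addrA (le_lt_trans (ler_normD _ _))//.
    by rewrite ltrD// distrC (lt_trans st).
  have xt' : `|x - t| < r by rewrite (lt_le_trans xt)// ler_pdivrMr// ler_peMr ?ler1n// ltW.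
  have := rF _ xs; have := rF _ xt'; rewrite !ltr_norml => /andP[? ?] /andP[? ?].
  by rewrite /F; apply/andP; split; lra.
exists d => // s t sab tab st.
by have := dP t tab s st; rewrite /F !clamp_id.
Qed.

(** Below the modulus [d] of uniform continuity [e] suffices; beyond it [(s - t)^2 / d^2 >= 1] and
    the oscillation is at most [2 * Z]. *)
Lemma continuous_itv_quadratic e : 0 < e -> exists2 K, 0 <= K &
  forall s t, s \in `[a, b] -> t \in `[a, b] ->
    `|f s - f t| <= e + K * (s - t) ^+ 2.
Proof.
move=> e0; have [Z Z0 fZ] := continuous_itv_bounded.
have [d d0 fd] := continuous_itv_uniform _ e0.
have d20 : 0 < d ^+ 2 by rewrite exprn_gt0.
exists (2 * Z / d ^+ 2) => [|s t sab tab].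
  by rewrite divr_ge0 ?mulr_ge0// ltW.
have [/fd h|ds] := ltP `|s - t| d.
  rewrite (le_trans (ltW (h sab tab)))// lerDl mulr_ge0 ?sqr_ge0//.
  by rewrite divr_ge0 ?mulr_ge0// ltW.
apply: (@le_trans _ _ (2 * Z)).
  rewrite (le_trans (ler_normB _ _))//.
  by have := fZ _ sab; have := fZ _ tab; lra.
have : d ^+ 2 <= (s - t) ^+ 2.
  by rewrite -(real_normK (num_real (s - t))) lerXn2r ?nnegrE// ltW.
move=> h; rewrite (@le_trans _ _ (2 * Z / d ^+ 2 * d ^+ 2))//.
  by rewrite divfK// gt_eqF.
by rewrite ler_wpDl// ?ler_wpM2l// ?divr_ge0 ?mulr_ge0// ltW.
Qed.

End Clamp.

(** * The quantum MKZ operator *)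

Section MKZOperator.
Variables (R : realType) (a b : R) (n : nat) (q : R) (f : R -> R).
Hypothesis ab : a < b.
Hypothesis n_gt0 : (0 < n)%N.
Hypothesis q01 : 0 < q <= 1.
Hypothesis cf : {within `[a, b], continuous f}.

Let L_gt0 : 0 < b - a. Proof. by rewrite subr_gt0. Qed.
Let L_ge0 : 0 <= b - a. Proof. exact: ltW. Qed.
Let L_neq0 : b - a != 0. Proof. by rewrite gt_eqF. Qed.

Local Notation y t := ((t - a) / (b - a)).
Local Notation s := (mkz_node R q n).
Local Notation pt k := (a + (b - a) * s k).

Lemma itv_normalize t : a <= t < b -> 0 <= y t < 1.
Proof.
move=> /andP[at_ tb].
apply/andP; split; first by rewrite divr_ge0// subr_ge0.
by rewrite ltr_pdivrMr// mul1r ltrD2r.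
Qed.

Lemma mkz_point_itv k : pt k \in `[a, b].
Proof.
rewrite in_itv/= lerDl mulr_ge0 ?mkz_node_ge0//=.
by rewrite -lerBrDl -[leRHS]mulr1 ler_wpM2l ?mkz_node_le1.
Qed.

Lemma PnqE t : Pnq a b n q t = \prod_(0 <= j < n.+1) (1 - q ^+ j * y t).
Proof.
rewrite /Pnq; apply: (mulIf (expf_neq0 n.+1 L_neq0)); rewrite divfK ?expf_neq0//.
rewrite -[X in (b - a) ^+ X](subn0 n.+1) -prodr_const_nat -big_split/=.
by apply: eq_bigr => j _; field.
Qed.

Lemma mkz_point_bounded : exists2 Z, 0 <= Z & forall k, `|f (pt k)| <= Z.
Proof.
have [Z Z0 fZ] := continuous_itv_bounded _ _ _ (ltW ab) _ cf.
by exists Z => // k; apply: fZ; exact: mkz_point_itv.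
Qed.

(** The prefactor may enter the limit because the weighted series converges. *)
Lemma MKZE t : a <= t < b ->
  MKZ a b n q f t = limn (series (fun k => mkz_weight R q n (y t) k * f (pt k))).
Proof.
move=> atb; have y01 := itv_normalize _ atb.
have /andP[_ tb] := atb; rewrite /MKZ lt_eqF// PnqE.
have [Z _ fZ] := mkz_point_bounded.
set P := \prod_(_ <= _ < _) _.
have P0 : P != 0 by rewrite gt_eqF// mkz_prod_gt0.
have cw := is_cvg_weighted_series _ _ _ _ (mkz_weight_ge0 _ _ n _ q01 y01) fZ
  (cvgP _ (mkz_weight_sum _ _ n _ q01 y01)).
set u := series (fun k => qbinom q (n + k) k * _ * _).
rewrite (_ : u = fun m => P^-1 *
    series (fun k => mkz_weight R q n (y t) k * f (pt k)) m).
  have -> : limn (fun m => P^-1 *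
      series (fun k => mkz_weight R q n (y t) k * f (pt k)) m) =
      P^-1 * limn (series (fun k => mkz_weight R q n (y t) k * f (pt k))).
    by apply: cvg_lim => //; exact: cvgMl_tmp.
  by rewrite mulVKf.
apply/funext => m; rewrite /u !seriesEnat/= mulr_sumr; apply: eq_bigr => k _.
by rewrite /mkz_weight -/P -!mulrA mulKf.
Qed.

Lemma MKZ_end : MKZ a b n q f b = f b.
Proof. by rewrite /MKZ eqxx. Qed.

Lemma MKZ_dist e K t : 0 <= e -> 0 <= K -> t \in `[a, b] ->
  (forall u, u \in `[a, b] -> `|f u - f t| <= e + K * (u - t) ^+ 2) ->
  `|MKZ a b n q f t - f t| <=
    e + K * (b - a) ^+ 2 * (y t / qint q n).
Proof.
move=> e0 K0 tab fe.
have /andP[at_ tb] : a <= t <= b by rewrite in_itv/= in tab.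
have KL : 0 <= K * (b - a) ^+ 2 by rewrite mulr_ge0 ?sqr_ge0.
(* At [t = b] the rescaled variable equals 1, outside the range of the series, and the operator
   takes its prescribed value. *)
have [->|tb'] := eqVneq t b.
  rewrite MKZ_end subrr normr0 addr_ge0// mulr_ge0// mulr_ge0 ?invr_ge0 ?qint_ge0//.
  by rewrite divff.
have atb : a <= t < b by rewrite at_ lt_neqAle tb'.
rewrite MKZE//; have [Z _ fZ] := mkz_point_bounded.
apply: (mkz_dist _ _ _ _ q01 (itv_normalize _ atb) n_gt0 _ _ _ _ _ fZ) => // k.
rewrite (le_trans (fe _ (mkz_point_itv k)))// lerD2l -mulrA ler_wpM2l//.
by rewrite -exprMn le_eqVlt; apply/orP; left; apply/eqP; congr (_ ^+ 2); field.
Qed.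

Lemma MKZ_dist_end e K t : 0 <= K -> a <= t < b ->
  (forall u, u \in `[a, b] -> `|f u - f b| <= e + K * (u - b) ^+ 2) ->
  `|MKZ a b n q f t - f b| <= e + K * (b - a) * (b - t).
Proof.
move=> K0 atb fe.
rewrite MKZE//; have [Z _ fZ] := mkz_point_bounded.
rewrite (_ : K * (b - a) * (b - t) = K * (b - a) ^+ 2 * (1 - y t)); last by field.
apply: (mkz_dist_endpoint _ _ _ _ q01 (itv_normalize _ atb) n_gt0 _ _ _ _ _ fZ) => // k.
rewrite (le_trans (fe _ (mkz_point_itv k)))// lerD2l -mulrA ler_wpM2l//.
rewrite (_ : _ - b = (b - a) * - (1 - s k)); last by ring.
rewrite exprMn sqrrN ler_wpM2l ?sqr_ge0// expr2.
(* Nodes lie in [[0, 1]], so [(1 - s k)^2 <= 1 - s k]. *)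
have h1 := mkz_node_le1 _ _ n q01 k; have h0 := mkz_node_ge0 _ _ n q01 k.
by rewrite ler_piMl ?subr_ge0// gerBl.
Qed.

(** At [a] the rescaled variable is 0, which removes the [K] term from [MKZ_dist] and leaves an
    arbitrary [e]. *)
Lemma MKZ_start : MKZ a b n q f a = f a.
Proof.
have aab : a \in `[a, b] by rewrite in_itv/= lexx ltW.
apply/eqP; rewrite -subr_eq0 -normr_le0; apply/ler_addgt0Pl => e e0.
have [K K0 fK] := continuous_itv_quadratic _ _ _ (ltW ab) _ cf _ e0.
have := @MKZ_dist e K a (ltW e0) K0 aab (fun u uab => fK u a uab aab).
by rewrite subrr !mul0r mulr0 !addr0.
Qed.

Lemma MKZ_le Z t : (forall u, u \in `[a, b] -> `|f u| <= Z) ->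
  t \in `[a, b] -> `|MKZ a b n q f t| <= Z.
Proof.
move=> fZ; rewrite in_itv/= => /andP[at_ tb].
have [->|tb'] := eqVneq t b.
  by rewrite MKZ_end fZ// in_itv/= lexx ltW.
have atb : a <= t < b by rewrite at_ lt_neqAle tb'.
have w1 := mkz_weight_sum _ _ n _ q01 (itv_normalize _ atb).
have fZ' k := fZ _ (mkz_point_itv k).
rewrite MKZE// -[X in `|X|]subr0 -[Z]mulr1.
apply: (weighted_series_dist _ _ _ _ (mkz_weight_ge0 _ _ n _ q01 (itv_normalize _ atb))
  fZ' (fun=> Z) (fun m => Z * series (mkz_weight R q n (y t)) m)) => //.
- by move=> k; rewrite subr0.
- move=> m; rewrite !seriesEnat/= mulr_sumr le_eqVlt; apply/orP; left; apply/eqP.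
  by apply: eq_bigr => k _; rewrite mulrC.
- exact: cvgMl_tmp.
Qed.

Lemma MKZ_ge0 t : (forall u, u \in `[a, b] -> 0 <= f u) ->
  t \in `[a, b] -> 0 <= MKZ a b n q f t.
Proof.
move=> f0; rewrite in_itv/= => /andP[at_ tb].
have [->|tb'] := eqVneq t b.
  by rewrite MKZ_end f0// in_itv/= lexx ltW.
have atb : a <= t < b by rewrite at_ lt_neqAle tb'.
have y01 := itv_normalize _ atb.
have [Z _ fZ] := mkz_point_bounded.
rewrite MKZE//; apply: limr_ge.
  exact: (is_cvg_weighted_series _ _ _ _ (mkz_weight_ge0 _ _ n _ q01 y01) fZ
    (cvgP _ (mkz_weight_sum _ _ n _ q01 y01))).
near=> m; rewrite seriesEnat/=; apply: sumr_ge0 => k _.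
by rewrite mulr_ge0 ?mkz_weight_ge0// f0// mkz_point_itv.
Unshelve. all: by end_near. Qed.

Lemma continuous_MKZ_interior t : a <= t < b -> {for t, continuous (MKZ a b n q f)}.
Proof.
move=> atb; have /andP[y0 y1] := itv_normalize _ atb; have /andP[_ tb] := atb.
pose c (k : nat) : R := qbinom q (n + k) k.
(* [g] is the series formula without the case distinction; it agrees with the operator to the left
   of [b]. *)
pose g x := Pnq a b n q x * limn (series (fun k => c k * (y x) ^+ k * f (pt k))).
suff cg : {for t, continuous g}.
  have MKZg : MKZ a b n q f t = g t by rewrite /MKZ lt_eqF.
  suff : MKZ a b n q f x @[x --> t] --> MKZ a b n q f t by [].
  rewrite MKZg; apply: cvg_trans cg.
  apply: near_eq_cvg; near=> x.
  by rewrite /MKZ lt_eqF//; near: x; exact: lt_nbhsl.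
have cy : {for t, continuous (fun x => y x)}.
  by apply: cvgMr_tmp; apply: cvgB; [exact: cvg_id|exact: cvg_cst].
apply: cvgM.
  suff : Pnq a b n q x @[x --> t] --> Pnq a b n q t by [].
  under eq_fun do rewrite PnqE.
  rewrite PnqE; apply: cvg_big => [|j _]; first exact: mul_continuous.
  by apply: cvgB; [exact: cvg_cst|exact: cvgMl_tmp].
have [Z Z0 fZ] := mkz_point_bounded.
(* A radius strictly between [y t] and 1: near [t] the series is dominated by its value at [r], up
   to the factor [Z]. *)
pose r := (1 + y t) / 2.
have r01 : 0 <= r < 1 by rewrite /r; apply/andP; split; lra.
have /andP[r0 r1] := r01.
apply: (@continuous_series _ (fun k => Z * (c k * r ^+ k))).
- rewrite (_ : series _ = fun m => Z * series (fun k => c k * r ^+ k) m).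
    by apply: is_cvgMl_tmp; apply: cvgP; exact: q_binomial_series.
  by apply/funext => m; rewrite !seriesEnat/= mulr_sumr.
- move=> k; apply: cvgMr_tmp; apply: cvgMl_tmp.
  exact: (@cvg_comp _ _ _ (fun x => y x) (fun z => z ^+ k) (nbhs t)
    (nbhs (y t)) (nbhs (y t ^+ k)) cy (@exprn_continuous R k (y t))).
- near=> x => k.
  have yr : `|y x| <= r.
    near: x; apply: (cvgr_norm_le _ cy).
    by rewrite ger0_norm// /r; lra.
  have c0 : 0 <= c k by rewrite ltW// qbinom_gt0.
  rewrite normrM mulrC ler_pM// normrM (ger0_norm c0) ler_wpM2l// normrX.
  by rewrite lerXn2r ?nnegrE.
Unshelve. all: by end_near. Qed.

(** At [b], where the value is imposed separately, [MKZ_dist_end] supplies the limit. *)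
Lemma continuous_MKZ : {within `[a, b], continuous (MKZ a b n q f)}.
Proof.
apply/subspace_continuousP => t; rewrite /= in_itv/= => /andP[at_ tb].
have [->|tb'] := eqVneq t b; last first.
  apply: cvg_within_filter; apply: continuous_MKZ_interior.
  by rewrite at_ lt_neqAle tb'.
have bab : b \in `[a, b] by rewrite in_itv/= lexx ltW.
apply/cvgrPdist_lt => e e0; have e2 : 0 < e / 2 by rewrite divr_gt0.
have [K K0 fK] := continuous_itv_quadratic _ _ _ (ltW ab) _ cf _ e2.
(* The added 1 keeps the divisor positive when [K = 0]. *)
have KL0 : 0 < K * (b - a) + 1 by rewrite ltr_wpDl// mulr_ge0// ltW.
rewrite near_withinE; near=> x.
rewrite /= in_itv/= => /andP[ax]; rewrite le_eqVlt => /predU1P[->|xb].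
  by rewrite subrr normr0.
rewrite /from_subspace MKZ_end distrC.
have axb : a <= x < b by rewrite ax.
apply: (le_lt_trans (@MKZ_dist_end _ _ _ K0 axb (fun u uab => fK u b uab bab))).
have : `|b - x| < e / 2 / (K * (b - a) + 1).
  near: x; apply: nbhsx_ballx; by rewrite divr_gt0.
rewrite ltr_pdivlMr// ger0_norm ?subr_ge0 ?(ltW xb)// => h.
have bx : 0 < b - x by rewrite subr_gt0.
rewrite [ltRHS]splitr ltrD2l (le_lt_trans _ h)// mulrC ler_wpM2l ?lerDl//.
exact: ltW.
Unshelve. all: by end_near. Qed.

End MKZOperator.

(** * The self-referential equation *)

Section FractalPerturbation.
Variables (R : realType) (N : nat) (x a b : nat -> R).
Hypothesis N2 : (2 <= N)%N.
Hypothesis xlt : forall i, (1 <= i < N)%N -> x i < x i.+1.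
Hypothesis ux : forall i, (1 <= i < N)%N ->
  a i * x 1%N + b i = x i /\ a i * x N + b i = x i.+1.

Local Notation A := (x 1%N).
Local Notation B := (x N).
Local Notation u i t := (a i * t + b i).

Lemma partition_le i j : (1 <= i)%N -> (i <= j)%N -> (j <= N)%N -> x i <= x j.
Proof.
move=> i1; elim: j => [|j IH]; first by case: i i1.
rewrite leq_eqVlt => /predU1P[->//|ij jN].
by rewrite (le_trans (IH _ (ltnW jN)))// ltW// xlt// (leq_trans i1).
Qed.

Lemma partition_lt : A < B.
Proof.
apply: (lt_le_trans (xlt 1%N _)); first by rewrite N2.
exact: partition_le.
Qed.

Let AB : A <= B. Proof. exact/ltW/partition_lt. Qed.

Lemma slope_gt0 i : (1 <= i < N)%N -> 0 < a i.
Proof.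
move=> iN; have [e1 e2] := ux _ iN; have := xlt _ iN.
rewrite -e1 -e2 ltrD2r -subr_gt0 -mulrBr pmulr_lgt0// subr_gt0.
exact: partition_lt.
Qed.

Lemma piece_itv i t : (1 <= i < N)%N -> t \in `[A, B] -> u i t \in `[x i, x i.+1].
Proof.
move=> iN; have [<- <-] := ux _ iN; have a0 := slope_gt0 _ iN.
by rewrite !in_itv/= !lerD2r !ler_pM2l.
Qed.

Lemma piece_itv_full i t : (1 <= i < N)%N -> t \in `[A, B] -> u i t \in `[A, B].
Proof.
move=> iN /(piece_itv _ _ iN); have /andP[i1 i2] := iN.
rewrite !in_itv/= => /andP[h1 h2]; apply/andP; split.
  by rewrite (le_trans _ h1)// partition_le// ltnW.
by rewrite (le_trans h2)// partition_le.
Qed.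

(** Makes every bound on the images of the maps [u i] a bound on the whole interval. *)
Lemma piece_cover t : t \in `[A, B] ->
  exists i, exists2 t', (1 <= i < N)%N /\ t' \in `[A, B] & t = u i t'.
Proof.
rewrite in_itv/= => /andP[At tB].
have [i iN /andP[it ti]] : exists2 i, (1 <= i < N)%N & x i <= t <= x i.+1.
  (* Induction on the right index locates a first partition point not below [t]. *)
  have : forall m, (2 <= m <= N)%N -> t <= x m ->
      exists2 i, (1 <= i < N)%N & x i <= t <= x i.+1.
    elim=> // m IH /andP[m2 mN] tm.
    have [tm'|tm'] := leP t (x m).
      case: (ltnP 1 m) => m1; first by apply: IH; rewrite // m1 ltnW.
      have m1' : m = 1%N by apply/eqP; rewrite eqn_leq m1.
      by exists 1%N; rewrite ?N2// At (le_trans tm')// m1' ltW// xlt.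
    by exists m; rewrite ?(ltW tm')//= mN andbT.
  by move=> /(_ N); apply; rewrite ?N2 ?leqnn.
have a0 := slope_gt0 _ iN; have [e1 e2] := ux _ iN.
exists i, ((t - b i) / a i); last by rewrite mulrC divfK ?gt_eqF// subrK.
split=> //; rewrite in_itv/= ler_pdivlMr// ler_pdivrMr//.
by rewrite lerBrDr lerBlDr mulrC e1 it mulrC e2 ti.
Qed.

Variables (alpha : nat -> R -> R) (s : R).
Hypothesis calpha : forall i, (1 <= i < N)%N ->
  {within `[A, B], continuous (alpha i)}.
Hypothesis s0 : 0 <= s.
Hypothesis s1 : s < 1.
Hypothesis alphas : forall i t, (1 <= i < N)%N -> t \in `[A, B] ->
  `|alpha i t| <= s.

Local Notation cl := (clamp R A B).

(* At a point of the i-th piece the summands j != i are evaluated at an endpoint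
   of [A, B], because of the clamping; they vanish when w does there, so that no
   gluing of pieces is needed. *)
Definition piecewise_op (w : R -> R) (t : R) : R :=
  \sum_(1 <= i < N) (alpha i (cl ((cl t - b i) / a i)) *
                     w (cl ((cl t - b i) / a i))).

Lemma continuous_piecewise_op w : {within `[A, B], continuous w} ->
  continuous (piecewise_op w).
Proof.
move=> cw.
(* Index membership is put into the sum because [calpha] only covers [1 <= i < N]. *)
rewrite (_ : piecewise_op w = fun t => \sum_(i <- index_iota 1 N |
    i \in index_iota 1 N) (alpha i (cl ((cl t - b i) / a i)) *
                            w (cl ((cl t - b i) / a i)))); last first.
  by apply/funext => t; rewrite /piecewise_op big_seq.
move=> t; apply: cvg_big => [|i]; first exact: add_continuous.
rewrite mem_index_iota => iN.
have cv : {for t, continuous (fun t => (cl t - b i) / a i)}.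
  by apply: cvgMr_tmp; apply: cvgB; [exact: continuous_clamp|exact: cvg_cst].
apply: cvgM.
  exact: (cvg_comp _ (fun z => alpha i (cl z)) cv
    (continuous_comp_clamp _ _ _ AB _ (calpha _ iN) _)).
exact: (cvg_comp _ (fun z => w (cl z)) cv
  (continuous_comp_clamp _ _ _ AB _ cw _)).
Qed.

Lemma piecewise_opE w i t : w A = 0 -> w B = 0 ->
  (1 <= i < N)%N -> t \in `[A, B] -> piecewise_op w (u i t) = alpha i t * w t.
Proof.
move=> wA wB iN tAB; have utAB := piece_itv_full _ _ iN tAB.
have := piece_itv _ _ iN tAB; rewrite in_itv/= => /andP[h1 h2].
have ai := slope_gt0 _ iN; have /andP[i1 i2] := iN.
rewrite /piecewise_op clamp_id// (bigD1_seq i) ?mem_index_iota ?iota_uniq//=.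
rewrite addrK mulrAC divff ?gt_eqF// mul1r clamp_id//.
rewrite big_seq_cond big1 ?addr0// => j; rewrite mem_index_iota => /andP[jN ji].
have aj := slope_gt0 _ jN; have [e1 e2] := ux _ jN; have /andP[j1 j2] := jN.
(* A piece [j > i] lies to the right of the point, so the preimage clamps to [A]; for [j < i] it
   clamps to [B]. At both, [w] vanishes. *)
have [ij|ij] := ltnP i j.
  rewrite clamp_le ?wA ?mulr0// ler_pdivrMr// lerBlDr (mulrC A) e1.
  by rewrite (le_trans h2)// partition_le// ltnW.
rewrite clamp_ge ?wB ?mulr0// ler_pdivlMr// lerBrDr (mulrC B) e2.
by rewrite (le_trans _ h1)// partition_le// ?ltn_neqAle ?ji// ltnW.
Qed.

Lemma piecewise_op_start w : w A = 0 -> w B = 0 -> piecewise_op w A = 0.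
Proof.
move=> wA wB; have N1 : (1 <= 1 < N)%N by rewrite N2.
have [e _] := ux _ N1.
by rewrite -{1}e piecewise_opE ?wA ?mulr0// in_itv/= lexx.
Qed.

Lemma piecewise_op_end w : w A = 0 -> w B = 0 -> piecewise_op w B = 0.
Proof.
move=> wA wB; have N1 : (1 <= N.-1 < N)%N by case: N N2 => [|[|k]]//=.
have [_] := ux _ N1; rewrite prednK; last by case: N N2.
by move=> e; rewrite -{1}e piecewise_opE ?wB ?mulr0// in_itv/= lexx andbT.
Qed.

Lemma piecewise_op_le w m : w A = 0 -> w B = 0 ->
  (forall t, t \in `[A, B] -> `|w t| <= m) ->
  forall t, `|piecewise_op w t| <= s * m.
Proof.
move=> wA wB wm t.
(* The operator sees its argument only through [cl], so a bound on the segment holds on the whole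
   line. *)
have -> : piecewise_op w t = piecewise_op w (cl t).
  by rewrite /piecewise_op (clamp_id _ _ _ (cl t))// clamp_itv.
have [i [t' [iN t'AB] ->]] := piece_cover _ (clamp_itv _ _ _ AB t).
by rewrite piecewise_opE// normrM ler_pM// ?alphas// wm.
Qed.

Variable d : R -> R.
Hypothesis cd : {within `[A, B], continuous d}.
Hypothesis dA : d A = 0.
Hypothesis dB : d B = 0.

Lemma piecewise_iter_end k : iter k piecewise_op d A = 0 /\ iter k piecewise_op d B = 0.
Proof.
elim: k => [//|k [IHA IHB]] /=.
by rewrite piecewise_op_start ?piecewise_op_end.
Qed.

Lemma perturbation_exists : exists2 h, continuous h &
  forall i, (1 <= i < N)%N -> forall t, t \in `[A, B] ->
    h (u i t) = alpha i t * (d t + h t).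
Proof.
have [D D0 dD] := continuous_itv_bounded _ _ _ AB _ cd.
(* The sum starts at the first iterate: unlike [d], all these terms are continuous on the whole
   line. *)
pose W k := iter k.+1 piecewise_op d.
have itA k := (piecewise_iter_end k).1; have itB k := (piecewise_iter_end k).2.
have cW k : continuous (W k).
  apply: continuous_piecewise_op; elim: k => [//|k IH].
  by apply: continuous_subspaceT; exact: continuous_piecewise_op.
have WD k t : `|W k t| <= s * D * s ^+ k.
  elim: k t => [|k IH] t.
    by rewrite mulr1; apply: piecewise_op_le.
  rewrite exprS mulrCA; apply: piecewise_op_le; first exact: (itA k.+1).
    exact: (itB k.+1).
  by move=> u _; exact: IH.
have cM : cvgn (series (fun k => s * D * s ^+ k)).
  by apply: is_cvg_geometric_series; rewrite ger0_norm.
exists (fun t => limn (series (W ^~ t))) => [t|i iN t tAB].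
  apply: (continuous_series _ _ cM) => [k|]; first exact: cW.
  by near=> y => k; exact: WD.
have cWt y : cvgn (series (W ^~ y)).
  by apply: (dominated_is_cvg_series _ _ cM) => k; exact: WD.
apply: cvg_lim => //; rewrite -cvg_shiftS.
(* Evaluation at [u i t] trades one application of the operator for the factor [alpha i t]; the
   lowest term becomes [d t]. *)
have -> : (fun m => series (W ^~ (u i t)) m.+1) =
    (fun m => alpha i t * (d t + series (W ^~ t) m)).
  apply/funext => m; rewrite !seriesEnat/= big_nat_recl// mulrDr mulr_sumr.
  congr (_ + _); first exact: piecewise_opE.
  apply: eq_bigr => k _; apply: piecewise_opE => //.
    exact: (itA k.+1).
  exact: (itB k.+1).
by apply: cvgMl_tmp; apply: cvgD; [exact: cvg_cst|exact: cWt].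
Unshelve. all: by end_near. Qed.

(* A bound that improves under self-reference to the pieces is attained only at
   the fixed point [r / (1 - s)] of [m |-> s * m + r]. *)
Lemma selfreferential_bound (h : R -> R) (H r : R) : 0 <= r ->
  (forall t, t \in `[A, B] -> h t <= H) ->
  (forall m, 0 <= m -> (forall t, t \in `[A, B] -> h t <= m) ->
    forall i t, (1 <= i < N)%N -> t \in `[A, B] -> h (u i t) <= s * m + r) ->
  forall t, t \in `[A, B] -> h t <= r / (1 - s).
Proof.
move=> r0 hH step.
have s1' : 0 < 1 - s by rewrite subr_gt0.
pose E := h @` `[A, B]; pose m := sup E.
have hE : has_sup E.
  split; first by exists (h A), A => //; rewrite /= in_itv/= lexx.
  by exists H => _ [t tAB <-]; exact: hH.
have hm t : t \in `[A, B] -> h t <= m.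
  by move=> tAB; apply: sup_upper_bound => //; exists t.
(* [step] is available for nonnegative bounds only; a nonpositive supremum already lies below
   [r / (1 - s)]. *)
have [m0|m0] := leP m 0.
  by move=> t /hm /le_trans; apply; rewrite (le_trans m0)// divr_ge0// ltW.
have mle : m <= s * m + r.
  apply: ge_sup; first exact: hE.1.
  move=> _ [t /= tAB <-]; have [i [t' [iN t'AB] ->]] := piece_cover _ tAB.
  by apply: step => //; exact: ltW.
move=> t /hm /le_trans; apply; rewrite ler_pdivlMr//; lra.
Qed.

End FractalPerturbation.

(** * Extrema over the interval, invariance of a band, growth of [[n]] *)

Section Norms.
Variables (R : realType) (a b Z : R) (g : R -> R).
Hypothesis gZ : forall t, t \in `[a, b] -> `|g t| <= Z.

Lemma minI_le t : t \in `[a, b] -> minI a b g <= g t.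
Proof.
move=> tab; apply: ge_inf; last by exists t.
by exists (- Z) => _ [u uab <-]; rewrite lerNl (le_trans _ (gZ _ uab))// -normrN ler_norm.
Qed.

Lemma le_maxI t : t \in `[a, b] -> g t <= maxI a b g.
Proof.
move=> tab; apply: ub_le_sup; last by exists t.
by exists Z => _ [u uab <-]; rewrite (le_trans (ler_norm _))// gZ.
Qed.

Lemma le_supnormI t : t \in `[a, b] -> `|g t| <= supnormI a b g.
Proof.
move=> tab; apply: ub_le_sup; last by exists t.
by exists Z => _ [u uab <-]; exact: gZ.
Qed.

End Norms.

(* In the degenerate case [Phin = 0] both quotients by [Phin] are junk zeros, so
   the hypotheses force [al = 0]. *)
Lemma invariant_step (R : realFieldType) (C phi Phi phin Phin al s m f0 g0 m0 : R) :
  0 <= Phin -> phin < C -> `|al| <= s -> 0 <= m ->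
  Num.max (- phi / (C - phin)) (- ((C - Phi) / Phin)) <= al ->
  al <= Num.min (phi / Phin) ((C - Phi) / (C - phin)) ->
  phi <= f0 <= Phi -> phin <= m0 <= Phin -> - m <= g0 <= C + m ->
  - (s * m) <= f0 + al * (g0 - m0) <= C + s * m.
Proof.
move=> Phin0 phinC als m_ge0; rewrite ge_max le_min => /andP[l1 l2] /andP[u1 u2].
move=> /andP[f1 f2] /andP[m1 m2] /andP[g1 g2].
have Cp : 0 < C - phin by rewrite subr_gt0.
rewrite ler_pdivrMr// in l1; rewrite ler_pdivlMr// in u2.
have [P0|P0] := ltP 0 Phin; last first.
  have P00 : Phin = 0 by apply/eqP; rewrite eq_le P0.
  rewrite P00 invr0 !mulr0 oppr0 in l2 u1.
  have al0 : al = 0 by apply/eqP; rewrite eq_le l2 u1.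
  rewrite al0 normr0 !mul0r in als l1 u2 *.
  by have := mulr_ge0 als m_ge0; move=> ?; apply/andP; split; lra.
rewrite -mulNr ler_pdivrMr// in l2; rewrite ler_pdivlMr// in u1.
have sm : `|al| * m <= s * m by rewrite ler_wpM2r.
(* For [al >= 0] the two upper bounds on [al] are used, for [al < 0] the two lower ones. *)
have [al0|al0] := leP 0 al.
  rewrite ger0_norm// in sm.
  have h1 := ler_wpM2l al0 g1; have h2 := ler_wpM2l al0 g2.
  have h3 := ler_wpM2l al0 m1; have h4 := ler_wpM2l al0 m2.
  by apply/andP; split; lra.
rewrite ltr0_norm// in sm.
have h1 := ler_wnM2l (ltW al0) g1; have h2 := ler_wnM2l (ltW al0) g2.
have h3 := ler_wnM2l (ltW al0) m1; have h4 := ler_wnM2l (ltW al0) m2.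
by apply/andP; split; lra.
Qed.

(** For fixed [m], [[m]] at [q n] tends to [m] by continuity of a finite sum, and [[n] >= [m]] once
    [n >= m]. *)
Lemma qint_unbounded (R : realType) (q : nat -> R) (H : R) :
  (forall n, (1 <= n)%N -> 0 < q n <= 1) ->
  q n @[n --> \oo] --> (1 : R) ->
  \forall n \near \oo, H < qint (q n) n.
Proof.
move=> q01 q1.
pose m := (Num.truncn (Num.max 0 H)).+1.
have Hm : H < m%:R.
  apply: (@le_lt_trans _ _ (Num.max 0 H)); first by rewrite le_max lexx orbT.
  by rewrite truncnS_gt.
have cvm : qint (q n) m @[n --> \oo] --> (m%:R : R).
  under eq_fun do rewrite qintE.
  have <- : \sum_(0 <= j < m) (1 : R) ^+ j = m%:R.
    by under eq_bigr do rewrite expr1n; rewrite sumr_const_nat subn0.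
  apply: cvg_big => [|j _]; first exact: add_continuous.
  exact: (cvg_comp _ (fun z => z ^+ j) q1 (@exprn_continuous R j 1)).
have h1 : \forall n \near \oo, H < qint (q n) m by apply: (cvgr_gt _ cvm).
near=> n.
have n1 : (1 <= n)%N by near: n; exact: nbhs_infty_ge.
have mn : (m <= n)%N by near: n; exact: nbhs_infty_ge.
apply: (@lt_le_trans _ _ (qint (q n) m)); first by near: n.
exact: (le_qint _ _ (q01 n n1)).
Unshelve. all: by end_near. Qed.

(** * Existence, approximation and sign of the fractal function *)

Section FractalFunction.
Variables (R : realType) (N : nat) (x a b : nat -> R) (f : R -> R).
Variables (alpha : nat -> R -> R).
Hypothesis N2 : (2 <= N)%N.
Hypothesis xlt : forall i, (1 <= i < N)%N -> x i < x i.+1.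
Hypothesis ux : forall i, (1 <= i < N)%N ->
  a i * x 1%N + b i = x i /\ a i * x N + b i = x i.+1.
Hypothesis cf : {within `[x 1%N, x N], continuous f}.
Hypothesis calpha : forall i, (1 <= i < N)%N ->
  {within `[x 1%N, x N], continuous (alpha i)}.

Local Notation A := (x 1%N).
Local Notation B := (x N).
Local Notation u := (fun i t => a i * t + b i).

Let s := \big[Num.max/0]_(1 <= i < N) supnormI A B (alpha i).
Hypothesis s1 : s < 1.

Let AB : A < B. Proof. exact: partition_lt. Qed.

(** Continuity bounds [alpha i], so that its norm is a genuine supremum and not a default value. *)
Lemma alpha_le_sup i t : (1 <= i < N)%N -> t \in `[A, B] -> `|alpha i t| <= s.
Proof.
move=> iN tAB; have [Z _ aZ] := continuous_itv_bounded _ _ _ (ltW AB) _ (calpha _ iN).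
apply: (le_trans (le_supnormI _ _ _ _ _ aZ _ tAB)).
by apply: (@le_bigmax_seq _ _ _ _ _ i); rewrite ?mem_index_iota.
Qed.

Lemma alpha_sup_ge0 : 0 <= s. Proof. exact: bigmax_ge_id. Qed.

Variables (n : nat) (q : R).
Hypothesis n_gt0 : (0 < n)%N.
Hypothesis q01 : 0 < q <= 1.

(** [xget] returns a solution as soon as one exists; the witness is [f + h], with [h] the
    perturbation built from [f] minus its MKZ image. *)
Lemma qMKZ_fractal_spec :
  is_qMKZ_fractal x N u alpha n q f (qMKZ_fractal x N u alpha n q f).
Proof.
apply: xgetPex.
have cM := continuous_MKZ _ _ _ _ _ _ AB n_gt0 q01 cf.
have [|||h ch hu] := perturbation_exists _ _ _ _ _ N2 xlt ux _ _ calpha alpha_sup_ge0 s1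
    alpha_le_sup (fun t => f t - MKZ A B n q f t).
- by move=> t; apply: cvgB; [exact: cf|exact: cM].
- by rewrite MKZ_start ?subrr.
- by rewrite MKZ_end subrr.
exists (fun t => f t + h t); split=> [t|i iN t tAB].
  by apply: cvgD; [exact: cf|exact: (continuous_subspaceT ch)].
by rewrite hu//; ring.
Qed.

Local Notation g := (qMKZ_fractal x N u alpha n q f).

Lemma qMKZ_fractal_bounded : exists2 Z, 0 <= Z & forall t, t \in `[A, B] -> `|g t| <= Z.
Proof.
by apply: continuous_itv_bounded; [exact: ltW|exact: qMKZ_fractal_spec.1].
Qed.

(** [selfreferential_bound] with [r = E]: from [|g - f| <= m] the equation gives the bound
    [s (m + E) <= s m + E]. *)
Lemma qMKZ_fractal_dist E : 0 <= E ->
  (forall t, t \in `[A, B] -> `|MKZ A B n q f t - f t| <= E) ->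
  forall t, t \in `[A, B] -> `|g t - f t| <= E / (1 - s).
Proof.
move=> E0 ME; have [Z Z0 gZ] := qMKZ_fractal_bounded.
have [Y Y0 fY] := continuous_itv_bounded _ _ _ (ltW AB) _ cf.
apply: (selfreferential_bound _ _ _ _ _ N2 xlt ux _ s1 (fun t => `|g t - f t|) (Z + Y)) => //.
  by move=> t tAB; rewrite (le_trans (ler_normB _ _))// lerD ?gZ ?fY.
move=> m m0 gm i t iN tAB; rewrite qMKZ_fractal_spec.2// addrC addKr normrM.
have h : `|g t - MKZ A B n q f t| <= m + E.
  rewrite -(subrK (f t) (g t)) -addrA (le_trans (ler_normD _ _))// lerD ?gm//.
  by rewrite distrC ME.
rewrite (le_trans (ler_pM _ _ (alpha_le_sup _ _ iN tAB) h))//.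
by rewrite mulrDr lerD2l ler_piMl// ltW.
Qed.

Variable C : R.
Hypothesis f_ge0 : forall t, t \in `[A, B] -> 0 <= f t.
Hypothesis C_gt : minI A B (MKZ A B n q f) < C.
Hypothesis alpha_bounds : forall i t, (1 <= i < N)%N -> t \in `[A, B] ->
  let phi := minI A B (fun s => f (u i s)) in
  let Phi := maxI A B (fun s => f (u i s)) in
  let phin := minI A B (MKZ A B n q f) in
  let Phin := maxI A B (MKZ A B n q f) in
  Num.max (- phi / (C - phin)) (- ((C - Phi) / Phin)) <= alpha i t /\
  alpha i t <= Num.min (phi / Phin) ((C - Phi) / (C - phin)).

(** Where [alpha] is negative the lower estimate needs an upper bound on [g], so both sides of the
    band [[0, C]] are tracked together. *)
Lemma qMKZ_fractal_ge0 t : t \in `[A, B] -> 0 <= g t.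
Proof.
have [Z Z0 gZ] := qMKZ_fractal_bounded.
have [Y Y0 fY] := continuous_itv_bounded _ _ _ (ltW AB) _ cf.
have MY v : v \in `[A, B] -> `|MKZ A B n q f v| <= Y by apply: MKZ_le.
move=> tAB.
(* A positive maximum measures how far [g] leaves [[0, C]]; taking [r = 0] forces it to be at most
   0. *)
suff : Num.max (- g t) (g t - C) <= 0 / (1 - s).
  by rewrite mul0r ge_max oppr_le0 => /andP[].
apply: (selfreferential_bound _ _ _ _ _ N2 xlt ux _ s1
  (fun v => Num.max (- g v) (g v - C)) (Z + `|C|)) tAB => //.
  move=> v vAB; rewrite ge_max; apply/andP; split.
    by rewrite ler_wpDr// (le_trans (ler_norm _))// normrN gZ.
  by rewrite (le_trans (ler_norm _))// (le_trans (ler_normB _ _))// lerD2r gZ.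
move=> m m0 gm i v iN vAB.
have := gm v vAB; rewrite addr0 !ge_max => /andP[g1 g2].
have [l r] := alpha_bounds _ _ iN vAB.
have fuY w : w \in `[A, B] -> `|f (u i w)| <= Y.
  by move=> wAB; apply: fY; exact: piece_itv_full.
have AAB : A \in `[A, B] by rewrite in_itv/= lexx ltW.
have Phin0 : 0 <= maxI A B (MKZ A B n q f).
  apply: (le_trans _ (le_maxI _ _ _ _ _ MY _ AAB)).
  exact: (MKZ_ge0 _ _ _ _ _ _ AB q01 cf _ f_ge0 AAB).
have := invariant_step _ _ _ _ _ _ _ _ _ (f (u i v)) (g v) (MKZ A B n q f v)
  Phin0 C_gt (alpha_le_sup _ _ iN vAB) m0 l r.
rewrite (minI_le _ _ _ _ _ fuY _ vAB) (le_maxI _ _ _ _ _ fuY _ vAB).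
rewrite (minI_le _ _ _ _ _ MY _ vAB) (le_maxI _ _ _ _ _ MY _ vAB).
rewrite -qMKZ_fractal_spec.2//.
have -> : - m <= g v <= C + m by rewrite lerNl g1 -lerBlDl.
by move=> /(_ isT isT isT) /andP[h1 h2]; rewrite lerNl h1 lerBlDl.
Qed.

End FractalFunction.

Theorem theorem4p1 (R : realType) (N : nat) (x : nat -> R)
  (a b : nat -> R) (f : R -> R) (q : nat -> R) (C : nat -> R)
  (alpha : nat -> R -> R) :
  (2 <= N)%N ->
  (forall i, (1 <= i < N)%N -> x i < x i.+1) ->
  (forall i, (1 <= i < N)%N ->
      a i * x 1%N + b i = x i /\ a i * x N + b i = x i.+1) ->
  {within `[x 1%N, x N], continuous f} ->
  (forall t, t \in `[x 1%N, x N] -> 0 <= f t) ->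
  (forall n, (1 <= n)%N -> 0 < q n <= 1) ->
  q n @[n --> \oo] --> (1 : R) ->
  (forall n, (1 <= n)%N ->
     0 < C n /\
     Num.max (minI (x 1%N) (x N) (MKZ (x 1%N) (x N) n (q n) f))
             (supnormI (x 1%N) (x N) f) < C n) ->
  (forall i, (1 <= i < N)%N -> {within `[x 1%N, x N], continuous alpha i}) ->
  \big[Num.max/0]_(1 <= i < N) supnormI (x 1%N) (x N) (alpha i) < 1 ->
  (forall n i t, (1 <= n)%N -> (1 <= i < N)%N -> t \in `[x 1%N, x N] ->
     let u := fun s => a i * s + b i in
     let phi := minI (x 1%N) (x N) (fun s => f (u s)) in
     let Phi := maxI (x 1%N) (x N) (fun s => f (u s)) in
     let phin := minI (x 1%N) (x N) (MKZ (x 1%N) (x N) n (q n) f) in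
     let Phin := maxI (x 1%N) (x N) (MKZ (x 1%N) (x N) n (q n) f) in
     Num.max (- phi / (C n - phin)) (- ((C n - Phi) / Phin)) <= alpha i t /\
     alpha i t <= Num.min (phi / Phin) ((C n - Phi) / (C n - phin))) ->
  let g := fun n => qMKZ_fractal x N (fun i s => a i * s + b i) alpha n (q n) f in
  (forall n, (1 <= n)%N -> forall t, t \in `[x 1%N, x N] -> 0 <= g n t) /\
  (forall e : R, 0 < e -> exists n0 : nat, forall n, (n0 <= n)%N ->
     forall t, t \in `[x 1%N, x N] -> `|g n t - f t| < e).
Proof.
move=> N2 xlt ux cf f_ge0 q01 q1 CC calpha s1 bounds g; split=> [n n1 t tAB|e e0].
  have [_] := CC n n1; rewrite gt_max => /andP[C_gt _].
  apply: (qMKZ_fractal_ge0 _ _ _ _ _ _ _ N2 xlt ux cf calpha s1 _ _ n1 (q01 n n1)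
    (C n)) => // i v iN vAB.
  exact: bounds.
have AB := partition_lt _ _ _ N2 xlt.
set s := \big[_/_]_(_ <= _ < _) _ in s1.
(* Then [E / (1 - s) = e / 2 < e]; half of [E] goes to the modulus of [f] and half to [K' / [n]]. *)
pose E := e * (1 - s) / 2.
have s1' : 0 < 1 - s by rewrite subr_gt0.
have E0 : 0 < E by rewrite !mulr_gt0.
have E2 : 0 < E / 2 by rewrite divr_gt0.
have [K K0 fK] := continuous_itv_quadratic _ _ _ (ltW AB) _ cf _ E2.
pose K' := K * (x N - x 1%N) ^+ 2.
have K'0 : 0 <= K' by rewrite mulr_ge0 ?sqr_ge0.
have [n0 _ Hn0] := qint_unbounded _ _ (K' / (E / 2)) q01 q1.
(* The maximum with 1 reflects that the hypotheses on [q n] start at [n = 1]. *)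
exists (maxn 1 n0) => n; rewrite geq_max => /andP[n1 n0n] t tAB.
have qn := q01 n n1.
apply: (@le_lt_trans _ _ (E / (1 - s))); last first.
  rewrite /E mulrAC mulfK ?gt_eqF// ltr_pdivrMr// ltr_pMr// ltr1n//.
apply: (qMKZ_fractal_dist _ _ _ _ _ _ _ N2 xlt ux cf calpha s1 _ _ n1 qn) => //.
  exact: ltW.
move=> v vAB.
apply: (le_trans (MKZ_dist _ _ _ _ _ _ AB n1 qn cf _ _ _ (ltW E2) K0 vAB _)).
  by move=> w wAB; exact: fK.
rewrite [leRHS]splitr lerD2l -/K'.
have Hq := Hn0 n n0n; have q0 : 0 < qint (q n) n.
  by rewrite (le_lt_trans _ Hq)// divr_ge0// ltW.
rewrite mulrA ler_pdivrMr//; rewrite /= ltr_pdivrMr// mulrC in Hq.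
(* The rescaled variable is at most 1, so the threshold does not depend on [v]. *)
apply: (le_trans _ (ltW Hq)); rewrite ler_piMr//.
move: vAB; rewrite in_itv/= => /andP[_ vB].
by rewrite ler_pdivrMr ?subr_gt0// mul1r lerD2r.
Qed.
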